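(* Let $T>0$, $f_0\in L^\infty(\mathbb{R})$, and assume that $f$ is a solution on the time interval $[0,T]$ of the Muskat equation $$\partial_t f(x,t)=\int_{\mathbb{R}}\frac{\alpha\,\delta_\alpha f'(x,t)}{(\delta_\alpha f(x,t))^2+\alpha^2}\,d\alpha$$ with $f(x,0)=f_0(x)$ and with the following properties: (a) $\sup_{t\in[0,T]}\|f'(t)\|_{L^\infty}<\infty$; (b) $f(x,t)\to0$ as $|x|\to\infty$, for all $t\le T$; (c) $\partial_t f(x,t)$ exists for all $(x,t)$ and $\|\partial_t f\|_{L^\infty(\mathbb{R}\times[0,T])}<\infty$; (d) $f'$ is uniformly continuous on $\mathbb{R}\times[0,T]$, in the sense that there exists a continuous, non-decreasing, bounded function $\rho:[0,\infty)\to[0,\infty)$ with $\rho(0)=0$ such that $|\delta_\alpha f'(x,t)|\le\rho(|\alpha|)$ for all $x,\alpha\in\mathbb{R}$ and $t\in[0,T]$. Then $f$ is the unique solution with initial datum $f_0(x)=f(x,0)$ satisfying all of the properties (a)–(d).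
   Context: Here $f=f(x,t)$ is a real-valued function of $x\in\mathbb{R}$ and $t\in[0,T]$; $f'=\partial_x f$ denotes the derivative in $x$; $\delta_\alpha g(x,t)=g(x,t)-g(x-\alpha,t)$. The integral over $\alpha\in\mathbb{R}$ is understood in the principal value sense. *)

(* Defs.v *)
From HB Require Import structures.
From mathcomp Require Import all_boot all_order all_algebra.
From mathcomp Require Import all_classical all_reals all_analysis.

Set Implicit Arguments.
Unset Strict Implicit.
Unset Printing Implicit Defensive.

Import Order.TTheory GRing.Theory Num.Theory.
Import numFieldNormedType.Exports.

Local Open Scope classical_set_scope.
Local Open Scope ring_scope.

(* Functions of (x, t), with x in R and t in [0, T], are total curried
   functions R -> R -> R; their values for t outside [0, T] are irrelevant. *)
Section muskat.
Context {R : realType}.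
Implicit Types (f : R -> R -> R) (T x t a : R).

Definition dx f x t : R := derive1 (f^~ t) x.

(* The time variable only ranges over [0, T], so the difference quotients are
   restricted to times in [0, T]: the derivative is one-sided at 0 and T. *)
Definition time_quotients T f x t : set_system R :=
  (f x s - f x t) / (s - t) @[s --> within `[0, T] t^'].

Definition derivable_t T f x t : Prop := cvg (time_quotients T f x t).

Definition dt T f x t : R := lim (time_quotients T f x t).

Definition delta a f x t : R := f x t - f (x - a) t.

(* Principal value over R, both at 0 and at infinity: [l] is the limit of the
   integrals over e < |a| < r as e -> 0+ and r -> +oo independently. *)
Definition is_pv (F : R -> R) (l : R) : Prop :=
  let annulus (e r : R) := [set a : R | e < `|a| < r] in
  (forall e r : R, 0 < e ->
     (@lebesgue_measure R).-integrable (annulus e r) (EFin \o F)) /\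
  \int[@lebesgue_measure R]_(a in annulus p.1 p.2) F a
    @[p --> filter_prod (0 : R)^'+ (pinfty_nbhs R)] --> l.

Definition muskat_integrand f x t a : R :=
  a * delta a (dx f) x t / (delta a f x t ^+ 2 + a ^+ 2).

Definition muskat_solution T (f0 : R -> R) f : Prop :=
  [/\ forall x t, t \in `[0, T] -> derivable (f^~ t) x 1,
      forall x t, t \in `[0, T] -> derivable_t T f x t,
      forall x t, t \in `[0, T] -> is_pv (muskat_integrand f x t) (dt T f x t)
    & forall x, f x 0 = f0 x].

Definition bounded_slope T f : Prop :=
  (ereal_sup [set 'N[@lebesgue_measure R]_+oo[EFin \o (dx f)^~ t]
             | t in `[0%R, T]] < +oo)%E.

Definition vanishes_at_infinity T f : Prop :=
  forall t, t \in `[0, T] ->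
    f x t @[x --> +oo] --> 0 /\ f x t @[x --> -oo] --> 0.

(* The L^oo norm over R x [0, T] is that of the extension by 0 to R x R. *)
Definition bounded_dt T f : Prop :=
  (forall x t, t \in `[0, T] -> derivable_t T f x t) /\
  finite_norm (@lebesgue_measure R \x @lebesgue_measure R)%E +oo%E
    ((fun p : R * R => dt T f p.1 p.2) \_ (setT `*` `[0, T])).

Definition slope_modulus T f : Prop :=
  exists rho : R -> R,
    [/\ {within `[0, +oo[, continuous rho},
        {in `[0, +oo[ &, {homo rho : u v / u <= v}},
        exists M, forall u : R, 0 <= u -> 0 <= rho u <= M,
        rho 0 = 0
      & forall x a t, t \in `[0, T] -> `|delta a (dx f) x t| <= rho `|a|].

Definition muskat_class T (f0 : R -> R) f : Prop :=
  [/\ muskat_solution T f0 f, bounded_slope T f, vanishes_at_infinity T f,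
      bounded_dt T f & slope_modulus T f].

End muskat.

(* Main.v *)
Require Import Defs.
From mathcomp Require Import all_boot all_order all_algebra.
From mathcomp Require Import all_classical all_reals all_analysis.
From mathcomp Require Import measurable_realfun ess_sup_inf ring lra.

Import Order.TTheory GRing.Theory Num.Theory.
Import numFieldNormedType.Exports.

Local Open Scope classical_set_scope.
Local Open Scope ring_scope.

(** Let [f] and [g] be two solutions with the same datum and [h = f - g].  The
    proof is a maximum principle for [m t], the maximum over [x] of
    [`|h x t|]: one shows that [m] grows at most exponentially, and [m 0 = 0].

    The heart of the matter is an inequality at a fixed time, at a point [x]
    where [h] attains its largest absolute value with [h x >= 0].  There [f]
    and [g] have the same slope [p].  With [df = f x - f (x - a)], the integrand
    [a (p - f' (x - a)) / (df^2 + a^2)] equals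
    [(a p - df) / (df^2 + a^2)] minus the derivative in [a] of [atan (df / a)].
    When [g] is subtracted the boundary terms vanish, because the chord
    slopes [df / a] and [dg / a] have the same limit [p] as [a] tends to [0]
    and the same limit [0] at infinity.  The remaining difference is
      [(df - dg) / a^2 * (e1 e2 - 1 - p^2) / ((1 + q1^2) (1 + q2^2))]
    where [q1], [q2] are the chord slopes and [e1 = q1 - p], [e2 = q2 - p].
    Maximality gives [0 <= df - dg <= 2 h x].  The modulus of continuity of the
    slopes gives [e1 e2 <= 1] for small [a], where the expression is therefore
    nonpositive, and [e1 e2 <= M^2] for all [a], where it is at most
    [2 M^2 h x / a^2].  Integrating, [f_t - g_t <= K h] at the point [x], with a
    constant [K] that depends only on the moduli ([muskat_difference_at_max]).

    To use this, [m] has to be continuous, which follows once [f] and [g] are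
    Lipschitz in time uniformly in [x] ([time_lipschitz]).  The time derivative
    is only essentially bounded on the strip, so for almost every [x] the
    function [f x] is differentiable everywhere with a derivative bounded
    almost everywhere; such a function is Lipschitz
    ([increment_le_of_ae_derivative]), and the remaining [x] follow by
    continuity in [x].

    Finally [exp (- (K + 1) t) m t] has a maximum over the time interval.  If it
    were positive, it would be reached at a positive time, and comparison with
    earlier times would force [`|h|] to grow at rate at least [K + 1] there,
    against the inequality above ([slower_than_exponential]). *)

(** * Functions with an almost everywhere bounded derivative *)

(** Induction along a segment: if [Q a b] failed, consider the infimum of the
    points [t] for which [Q a t] fails; the local hypothesis at that infimum
    carries the relation past it. *)
Lemma local_to_global (R : realType) (a b : R) (Q : R -> R -> Prop) :
  a <= b -> (forall x, Q x x) ->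
  (forall x y z, x <= y -> y <= z -> Q x y -> Q y z -> Q x z) ->
  (forall t, a <= t <= b -> exists2 e, 0 < e &
     forall s r, a <= s <= t -> t <= r <= b -> t - s < e -> r - t < e -> Q s r) ->
  Q a b.
Proof.
move=> ab Qxx Qtrans Qloc; apply: contrapT => nQab.
pose B := [set t | a <= t <= b /\ ~ Q a t].
have Bb : B b by split=> //; rewrite ab lexx.
have lbB : has_lbound B by exists a => t [/andP[]].
have infB : has_inf B by split=> //; exists b.
set t := inf B.
have at_ : a <= t by apply: lb_le_inf => [|s [/andP[]]//]; exists b.
have tb : t <= b by exact: ge_inf.
have [|e e0 Qe] := Qloc t; first by rewrite at_ tb.
have [r Br rt] := inf_adherent e0 infB.
have [/andP[ar rb] nQar] := Br.
have tr : t <= r by exact: ge_inf.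
have rte : r - t < e by rewrite ltrBlDl.
apply: nQar; have [ta|] := leP t a.
  have <- : t = a by apply/eqP; rewrite eq_le ta at_.
  by apply: Qe => //; rewrite ?at_ ?lexx ?tr ?rb ?subrr.
move=> at0; pose s := Num.max a (t - e / 2).
have as_ : a <= s by rewrite le_max lexx.
have st : s < t by rewrite gt_max at0/= ltrBlDr ltrDl divr_gt0.
apply: (Qtrans a s r) => //; first by rewrite (le_trans (ltW st)).
- apply: contrapT => nQas; have : B s by split=> //; rewrite as_ (le_trans (ltW st)).
  by move/(ge_inf lbB); rewrite leNgt st.
- apply: Qe => //; first by rewrite as_ ltW.
    by rewrite tr rb.
  have : t - e / 2 <= s by rewrite le_max lexx orbT.
  by lra.
Qed.

(** A small measure whose distribution function has infinite slope at every
    point of a null set: take the sum of the restrictions of Lebesgue measure to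
    open sets [U_n] that contain [N] and have measure at most [eps / 2^(n+1)].
    Near a point of [N] the first [k] of these sets contain whole intervals. *)
Lemma null_set_steep_measure (R : realType) (N : set R) (eps : R) :
  measurable N -> lebesgue_measure N = 0%E -> 0 < eps ->
  exists nu : {measure set (measurableTypeR R) -> \bar R},
    (forall A, measurable A -> (nu A <= eps%:E)%E) /\
    forall (k : nat) t, N t -> exists2 e, 0 < e &
      forall s r, s <= t <= r -> t - s < e -> r - t < e ->
        (((r - s) *+ k)%:E <= nu `]s, r]%classic)%E.
Proof.
move=> mN N0 eps0.
have /choice[U HU] : forall n, exists U : set R, [/\ open U, N `<=` U &
    (lebesgue_measure U <= (eps / (2 ^ n.+1)%:R)%:E)%E].
  move=> n; have [||U [oU NU UN]] := @lebesgue_regularity_outer R N (eps / (2 ^ n.+1)%:R) mN.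
  - by rewrite [X in (X < _)%E]N0.
  - by rewrite divr_gt0.
  exists U; split => //; have mU := open_measurable oU.
  rewrite -(setDUK NU) (le_trans (measureU2 _ _ _))//; first exact: measurableD.
  by rewrite [X in (X + _)%E]N0 add0e ltW.
have mU n : measurable (U n) by have [+ _ _] := HU n; exact: open_measurable.
pose m n : {measure set (measurableTypeR R) -> \bar R} :=
  mrestr lebesgue_measure (mU n).
exists (mseries m 0); split.
  move=> A mA; rewrite (le_trans _ (@epsilon_trick0 R eps xpredT (ltW eps0)))//.
  apply: lee_nneseries => // n _; have [_ _ Une] := HU n; apply: le_trans Une.
  rewrite /m/= /mrestr.
  apply: le_measure; rewrite ?inE//=; last exact: mU.
  by apply: measurableI => //; exact: mU.
move=> k t Nt.
have : \forall s \near t, forall i, (i < k)%N -> U i s.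
  elim: k => [|k IHk]; first by near=> s.
  near=> s => i; rewrite ltnS leq_eqVlt => /predU1P[->|].
    near: s; have [oU NU _] := HU k; apply: open_nbhs_nbhs; split=> //.
    exact: NU.
  by move: i; near: s.
move=> /nbhs_ballP[e /= e0 He]; exists e => // s r /andP[st tr] tse rte.
have sub i : (i < k)%N -> `]s, r]%classic `<=` U i.
  move=> ik y /=; rewrite in_itv/= => /andP[sy yr]; apply: He => //.
  by rewrite /ball/= ltr_norml; apply/andP; split; lra.
have nnm i : (0 <= i)%N -> true ->
    (0 <= mrestr lebesgue_measure (mU i) `]s, r]%classic)%E by [].
rewrite /mseries; apply: le_trans (nneseries_lim_ge k nnm).
rewrite (eq_big_nat _ _ (F2 := fun=> (r - s)%:E)) => [|i /andP[_ ik]].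
  by rewrite sumEFin sumr_const_nat subn0.
rewrite /mrestr setIidl; last exact: sub.
rewrite lebesgue_measure_itv/= lte_fin; case: ltP => // rs.
by have -> : r = s by [lra]; rewrite subrr.
Unshelve. all: by end_near. Qed.

(** The straddle lemma: a derivative below [c] controls the increments over
    all small intervals around [t], not only those that start at [t]. *)
Lemma local_increment (R : realType) (T : R) (u : R -> R) (t l c : R) :
  (u s - u t) / (s - t) @[s --> within `[0, T] t^'] --> l -> l < c ->
  exists2 e, 0 < e & forall s r, 0 <= s -> s <= t <= r -> r <= T ->
    t - s < e -> r - t < e -> u r - u s <= c * (r - s).
Proof.
move=> /cvgr_lt/[apply]/nbhs_ballP[e /= e0 He].
exists e => // s r s0 /andP[st tr] rT tse rte.
have Hr : u r - u t <= c * (r - t).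
  have [->|rt] := eqVneq r t; first by rewrite !subrr mulr0.
  have r0 : 0 < r - t by rewrite subr_gt0 lt_neqAle eq_sym rt.
  rewrite -ler_pdivrMr//; apply/ltW/He => //=; last first.
    by rewrite in_itv/=; apply/andP; split; lra.
  by rewrite /ball/= distrC ger0_norm ?(ltW r0).
have Hs : u t - u s <= c * (t - s).
  have [->|ts] := eqVneq s t; first by rewrite !subrr mulr0.
  have t0 : 0 < t - s by rewrite subr_gt0 lt_neqAle ts.
  rewrite -ler_pdivrMr// -[u t - _]opprB -[t - s]opprB invrN mulrNN.
  apply/ltW/He => //=; last first.
    by rewrite in_itv/=; apply/andP; split; lra.
  by rewrite /ball/= ger0_norm ?(ltW t0).
lra.
Qed.

(** The derivative exists everywhere but may exceed [C] on a null set, so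
    absolute continuity is not available beforehand.  Around a point where the
    derivative is at most [C] the increments of [u] have slope at most [C + d];
    around an exceptional point they are paid for by the steep measure of a null
    set.  Both bounds are additive over intervals, so they propagate. *)
Lemma increment_le_of_ae_derivative (R : realType) (T C : R) (u D : R -> R) :
  (forall t, 0 <= t <= T ->
     (u s - u t) / (s - t) @[s --> within `[0, T] t^'] --> D t) ->
  (@lebesgue_measure R).-negligible [set t | 0 <= t <= T /\ C < D t] ->
  forall a b, 0 <= a -> a <= b -> b <= T -> u b - u a <= C * (b - a).
Proof.
move=> uD [N [mN N0 subN]] a b a0 ab bT.
(* [d] is both the excess slope and the total mass of the steep measure *)
suff H d : 0 < d -> u b - u a <= C * (b - a) + d * (b - a) + d.
  apply/ler_addgt0Pr => e e0; have ba0 : 0 < b - a + 1 by lra.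
  have := H (e / (b - a + 1)); rewrite divr_gt0// => /(_ isT)/le_trans; apply.
  have -> : C * (b - a) + e / (b - a + 1) * (b - a) + e / (b - a + 1) =
    C * (b - a) + e by field; rewrite gt_eqF.
  by [].
move=> d0; have [nu [nud Hnu]] := @null_set_steep_measure R N d mN N0 d0.
clear mN N0.
have nufin s r : nu `]s, r]%classic \is a fin_num.
  by rewrite ge0_fin_numE// (le_lt_trans (nud _ _))// ltry.
have nu_ge0 s r : 0 <= fine (nu `]s, r]%classic) by exact: fine_ge0.
have : u b - u a <= (C + d) * (b - a) + fine (nu `]a, b]%classic).
  apply: (@local_to_global R a b
    (fun s r => u r - u s <= (C + d) * (r - s) + fine (nu `]s, r]%classic))) => //.
  - by move=> x; rewrite !subrr mulr0 add0r.
  - move=> x y z xy yz Hxy Hyz.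
    rewrite (@itv_bndbnd_setU _ _ _ (BRight y))// measureU//; last first.
      rewrite -subset0 => w [] /=; rewrite !in_itv/= => /andP[_ wy] /andP[yw _].
      by move: (lt_le_trans yw wy); rewrite ltxx.
    by rewrite fineD//=; lra.
  - move=> t /andP[at_ tb]; have t0T : 0 <= t <= T by apply/andP; split; lra.
    have [Dt|Dt] := leP (D t) C.
      have [|e e0 He] := local_increment _ _ _ _ _ (C + d) (uD t t0T); first lra.
      exists e => // s r /andP[as_ st] /andP[tr rb] tse rte.
      have := He s r; rewrite st tr => /(_ _ isT _ tse rte) H.
      by rewrite (le_trans (H _ _)) ?lerDl//; lra.
    have Nt : N t by apply: subN.
    (* an integer slope that absorbs the excess of the derivative over [C] *)
    pose k := (Num.truncn `|D t - C|).+1.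
    have kD : D t < C + d + k%:R.
      by have := truncnS_gt `|D t - C|; have := ler_norm (D t - C); rewrite /k; lra.
    have [e1 e10 He1] := Hnu k t Nt.
    have [e e0 He] := local_increment _ _ _ _ _ _ (uD t t0T) kD.
    exists (Num.min e e1); first by rewrite lt_min e0.
    move=> s r /andP[as_ st] /andP[tr rb]; rewrite !lt_min.
    move=> /andP[tse tse1] /andP[rte rte1].
    have := He1 s r; rewrite st tr => /(_ isT tse1 rte1).
    have := He s r; rewrite st tr => /(_ _ isT _ tse rte) => H.
    have {}H := H ltac:(lra) ltac:(lra).
    rewrite -[nu _]fineK// lee_fin -mulr_natl; lra.
move/le_trans; apply; rewrite mulrDl lerD2l -lee_fin fineK//; exact: nud.
Qed.

(** * Uniform Lipschitz continuity in time *)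

Lemma ae_dense (R : realType) (P : R -> Prop) :
  (\forall x \ae (@lebesgue_measure R), P x) ->
  forall y e, 0 < e -> exists2 x, `|x - y| < e & P x.
Proof.
move=> [N [mN N0 PN]] y e e0; apply: contrapT => nP.
have : (lebesgue_measure (ball y e) <= lebesgue_measure N)%E.
  apply: le_measure; rewrite ?inE//; first exact: measurable_ball.
  move=> x yx; apply: PN => /= Px; apply: nP; exists x => //.
  by rewrite distrC.
rewrite lebesgue_measure_ball ?(ltW e0)// N0 lee_fin leNgt.
by rewrite mulrn_wgt0.
Qed.

(** Almost every section of a null set of the plane is null. *)
Lemma ae_time_derivative_bound (R : realType) (T : R) (f : R -> R -> R) :
  bounded_dt T f -> exists2 L : R, 0 <= L &
  \forall x \ae (@lebesgue_measure R), (@lebesgue_measure R).-negligible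
    [set t | 0 <= t <= T /\ L < `|dt T f x t|].
Proof.
move=> [_]; rewrite /finite_norm unlock.
have mT : @lebesgue_measure R setT = +oo%E.
  by rewrite -set_itvNyy lebesgue_measure_itv.
have -> : ((@lebesgue_measure R \x @lebesgue_measure R)%E [set: R * R] > 0)%E.
  by rewrite -setXTT product_measure1E// mule_gt0// [ltRHS]mT.
set F := (X in EFin \o X).
have -> : abse \o (EFin \o F) = EFin \o (Num.norm \o F) by [].
move=> /ess_supr_bounded[M].
move=> [N [mN N0 subN]].
exists (Num.max M 0); first by rewrite le_max lexx orbT.
have mphi : measurable_fun setT (lebesgue_measure \o xsection N).
  exact: measurable_fun_xsection.
have /ae_eq_integral_abs := mphi => /(_ lebesgue_measure measurableT)[+ _].
under eq_integral do rewrite gee0_abs//.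
move=> /(_ N0); apply: filterS => x /(_ I)/= Nx0.
exists (xsection N x); split => //; first exact: measurable_xsection.
move=> t [t0T Mt]; rewrite /xsection/= inE; apply: subN => /=.
apply/negP; rewrite -ltNge /F patchE mem_set/=; last by split => //=; rewrite in_itv.
by move: Mt; rewrite gt_max => /andP[].
Qed.

(** For almost every [x] the estimate is that of the previous part, applied
    to [f x] and [- f x].  A failure at some [x] would persist on a
    neighbourhood, which contains such good points. *)
Lemma time_lipschitz (R : realType) (T : R) (f : R -> R -> R) :
  (forall x t, t \in `[0, T] -> derivable (f^~ t) x 1) ->
  bounded_dt T f ->
  exists2 L : R, 0 <= L & forall x s t, s \in `[0, T] -> t \in `[0, T] ->
    `|f x t - f x s| <= L * `|t - s|.
Proof.
move=> fx bdt; have [ft _] := bdt.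
have [L L0 /ae_dense HL] := ae_time_derivative_bound _ _ _ bdt.
exists L => // x.
suff H s t : 0 <= s -> s <= t -> t <= T -> `|f x t - f x s| <= L * (t - s).
  move=> s t; rewrite !in_itv/= => /andP[s0 sT] /andP[t0 tT].
  have [st|ts] := leP s t; first by rewrite [`|t - s|]ger0_norm ?subr_ge0// H.
  by rewrite distrC [`|t - s|]distrC [`|s - t|]gtr0_norm ?subr_gt0// H// ltW.
move=> s0 st tT; rewrite leNgt; apply/negP => Lst.
pose k y := f y t - f y s.
have : {for x, continuous (Num.norm \o k)}.
  apply: continuous_comp; last exact: norm_continuous.
  apply: continuousB; apply: differentiable_continuous;
    apply/derivable1_diffP/fx; rewrite in_itv/=; apply/andP; split; lra.
move=> /cvgr_gt/(_ _ Lst)/nbhs_ballP[e /= e0 He].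
have [y yxe [N [mN N0 subN]]] := HL x e e0.
have : L * (t - s) < `|k y| by apply: He; rewrite /ball/= distrC.
apply/negP; rewrite -leNgt ler_norml.
have ftD r : 0 <= r <= T ->
    (f y w - f y r) / (w - r) @[w --> within `[0, T] r^'] --> dt T f y r.
  by move=> r0T; apply: ft; rewrite in_itv.
have ftN r : 0 <= r <= T ->
    (- f y w - - f y r) / (w - r) @[w --> within `[0, T] r^'] --> - dt T f y r.
  move=> /ftD/cvgN; apply: cvg_trans; apply: near_eq_cvg; apply: nearW => w /=.
  by rewrite -mulNr opprB opprK addrC.
apply/andP; split; last first.
  apply: increment_le_of_ae_derivative ftD _ _ _ s0 st tT.
  exists N; split => // r [r0T Lr]; apply: subN; split => //.
  by rewrite (lt_le_trans Lr)// ler_norm.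
suff : - f y t - - f y s <= L * (t - s) by rewrite /k; lra.
apply: increment_le_of_ae_derivative ftN _ _ _ s0 st tT.
exists N; split => // r [r0T Lr]; apply: subN; split => //.
by rewrite (lt_le_trans Lr)// -normrN ler_norm.
Qed.

(** * The Muskat kernel in terms of chord slopes *)

Definition chord_slope {R : realType} (u : R -> R) (x a : R) : R :=
  (u x - u (x - a)) / a.

(** With [q1 = d1 / a] and [q2 = d2 / a], the difference of the two kernels is
    [(d1 - d2) / a^2] times [(q1 - p) (q2 - p) - 1 - p^2], divided by
    [(1 + q1^2) (1 + q2^2)].  It is nonpositive when both chord slopes are within
    [1] of [p], and otherwise bounded by [2 m M^2 / a^2]; the factor
    [(1 + r0^2) / r0^2] trades [1 / a^2] for the derivative of the arctangent
    when [`|a| >= r0]. *)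
Lemma chord_kernel_difference_le (R : realType) (p d1 d2 a m M r0 : R) :
  a != 0 -> 0 < r0 -> 0 <= M -> 0 <= d1 - d2 <= 2 * m ->
  `|d1 / a - p| <= M -> `|d2 / a - p| <= M ->
  (`|a| <= r0 -> `|d1 / a - p| <= 1 /\ `|d2 / a - p| <= 1) ->
  (a * p - d1) / (d1 ^+ 2 + a ^+ 2) - (a * p - d2) / (d2 ^+ 2 + a ^+ 2)
    <= 2 * m * M ^+ 2 * ((1 + r0 ^+ 2) / r0 ^+ 2) * (1 + a ^+ 2)^-1.
Proof.
move=> a0 r00 M0 /andP[d120 d12m] e1M e2M near0.
have E (z y : R) : `|z - p| <= y -> `|d2 / a - p| <= y ->
    (z - p) * (d2 / a - p) <= y ^+ 2.
  move=> zy dy; rewrite (le_trans (ler_norm _))// normrM expr2.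
  by rewrite ler_pM.
set q1 := d1 / a in e1M near0 *; set q2 := d2 / a in e2M near0 E *.
have d1E : d1 = a * q1 by rewrite /q1 mulrC divfK.
have d2E : d2 = a * q2 by rewrite /q2 mulrC divfK.
have a2 : 0 < a ^+ 2 by rewrite exprn_even_gt0.
have r2 : 0 < r0 ^+ 2 by rewrite exprn_gt0.
pose P := (1 + q1 ^+ 2) * (1 + q2 ^+ 2).
have P1 : 1 <= P.
  by rewrite /P; have := sqr_ge0 q1; have := sqr_ge0 q2; nra.
have -> : (a * p - d1) / (d1 ^+ 2 + a ^+ 2) - (a * p - d2) / (d2 ^+ 2 + a ^+ 2)
  = (d1 - d2) * ((q1 - p) * (q2 - p) - 1 - p ^+ 2) / (a ^+ 2 * P).
  rewrite /P d1E d2E; field.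
  have sq (y : R) : 0 < 1 + y ^+ 2 by rewrite ltr_pwDl// sqr_ge0.
  have sq' (y : R) : 0 < y ^+ 2 + a ^+ 2 by rewrite ltr_wpDl// sqr_ge0.
  by rewrite a0 !(gt_eqF (sq _)) !(gt_eqF (sq' _)).
have m0 : 0 <= m by lra.
have B2 := sqr_ge0 p.
have aP : 0 < a ^+ 2 * P by rewrite mulr_gt0//; lra.
have RHS0 : 0 <= 2 * m * M ^+ 2 * ((1 + r0 ^+ 2) / r0 ^+ 2) * (1 + a ^+ 2)^-1.
  by rewrite !mulr_ge0// ?invr_ge0 ?exprn_ge0 ?addr_ge0 ?ltW.
have [ar|ra] := leP `|a| r0.
  have [e1 e2] := near0 ar; have := E _ _ e1 e2; rewrite expr1n => B1.
  apply: le_trans RHS0; rewrite ler_pdivrMr// mul0r mulr_ge0_le0//; lra.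
have := E _ _ e1M e2M => BM.
have ra2 : r0 ^+ 2 <= a ^+ 2.
  by rewrite -[a ^+ 2]real_normK ?num_real// ler_pXn2r ?nnegrE// ltW.
have M2 := sqr_ge0 M.
apply: (@le_trans _ _ (2 * m * M ^+ 2 / a ^+ 2)).
  rewrite invfM mulrA mulrAC ler_wpM2r ?invr_ge0 ?(ltW a2)//.
  rewrite ler_pdivrMr; last lra.
  apply: (@le_trans _ _ (2 * m * M ^+ 2)).
    by apply: (@le_trans _ _ ((d1 - d2) * M ^+ 2)); rewrite ?ler_wpM2l ?ler_wpM2r//; lra.
  by rewrite ler_peMr// !mulr_ge0.
rewrite -[leRHS]mulrA ler_wpM2l ?mulr_ge0//.
rewrite ler_pdivlMr; last lra.
by rewrite mulrDr mulr1 mulVf ?gt_eqF// mulrDl mul1r mulfV ?gt_eqF// lerD2r lef_pV2.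
Qed.

Lemma integral_le_primitive (R : realType) (F H h : R -> R) (a b : R) :
  a < b ->
  (@lebesgue_measure R).-integrable `]a, b[ (EFin \o F) ->
  (forall x, a <= x <= b -> is_derive x 1 H (h x)) ->
  (forall x, a <= x <= b -> {for x, continuous h}) ->
  (forall x, a < x < b -> F x <= h x) ->
  \int[@lebesgue_measure R]_(x in `]a, b[) F x <= H b - H a.
Proof.
move=> ab iF dH ch Fh.
have ch' : {within `[a, b], continuous h}.
  by apply: continuous_in_subspaceT => x; rewrite inE/= in_itv/= => /ch.
have ih : (@lebesgue_measure R).-integrable `[a, b] (EFin \o h).
  by apply: continuous_compact_integrable => //; exact: segment_compact.
have ioh : (@lebesgue_measure R).-integrable `]a, b[ (EFin \o h).
  by apply: integrableS ih => //; exact: subset_itv_oo_cc.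
have ich : (@lebesgue_measure R).-integrable `[a, b[ (EFin \o h).
  by apply: integrableS ih => //; exact: subset_itv_co_cc.
have cH x : a <= x <= b -> {for x, continuous H}.
  move=> /dH dHx; apply: differentiable_continuous.
  exact/derivable1_diffP/ex_derive.
suff -> : H b - H a = \int[@lebesgue_measure R]_(x in `]a, b[) h x.
  by apply: le_Rintegral => // x /=; rewrite in_itv/= => /Fh.
rewrite Rintegral_itv_obnd_cbnd// Rintegral_itv_bndo_bndc//.
rewrite /Rintegral (@continuous_FTC2 _ h H)//.
- split.
  + move=> x; rewrite in_itv/= => /andP[ax xb].
    have := dH x; rewrite !ltW// => /(_ isT) dHx; exact: ex_derive.
  + by apply: cvg_at_right_filter; apply: cH; rewrite lexx ltW.
  + by apply: cvg_at_left_filter; apply: cH; rewrite lexx ltW.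
- move=> x; rewrite in_itv/= => /andP[ax xb].
  have := dH x; rewrite !ltW// => /(_ isT) dHx; rewrite derive1E; exact: derive_val.
Qed.

(** By the mean value theorem a chord slope is a value of the derivative. *)
Lemma chord_slope_dist (R : realType) (u : R -> R) (x a c : R) :
  (forall y, derivable u y 1) -> a != 0 ->
  (forall y, `|y - x| <= `|a| -> `|derive1 u y - derive1 u x| <= c) ->
  `|chord_slope u x a - derive1 u x| <= c.
Proof.
move=> du a0 Hc.
have duD (y : R) : is_derive y 1 u (derive1 u y) by rewrite derive1E; exact: derivableP.
have cu y z : {within `[y, z], continuous u}.
  apply: continuous_subspaceT => w.
  exact/differentiable_continuous/derivable1_diffP.
suff [y yx ->] : exists2 y, `|y - x| <= `|a| & chord_slope u x a = derive1 u y.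
  exact: Hc.
have [a_gt0|a_lt0|a_eq0] := ltgtP 0 a; last by rewrite a_eq0 eqxx in a0.
- have xa : x - a < x by lra.
  have [y /[!in_itv]/= /andP[y1 y2] E] := MVT xa (fun z _ => duD z) (cu _ _).
  exists y; first by rewrite (gtr0_norm a_gt0) ler_norml; lra.
  by rewrite /chord_slope E subKr mulfK.
- have xa : x < x - a by lra.
  have [y /[!in_itv]/= /andP[y1 y2] E] := MVT xa (fun z _ => duD z) (cu _ _).
  exists y; first by rewrite (ltr0_norm a_lt0) ler_norml; lra.
  by rewrite /chord_slope -opprB E addrAC subrr add0r mulrN opprK mulfK.
Qed.

(** This is the exact derivative that integration by parts splits off from
    the Muskat integrand. *)
Lemma is_derive_atan_chord (R : realType) (u : R -> R) (x a : R) :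
  (forall y, derivable u y 1) -> a != 0 ->
  is_derive a 1 (atan \o chord_slope u x)
    ((a * derive1 u (x - a) - (u x - u (x - a))) / ((u x - u (x - a)) ^+ 2 + a ^+ 2)).
Proof.
move=> du a0.
have duD (y : R) : is_derive y 1 u (derive1 u y) by rewrite derive1E; exact: derivableP.
have dshift : is_derive a 1 (fun b => x - b) (- 1).
  by apply: is_derive_eq; rewrite add0r mul1r.
have dcomp : is_derive a 1 (fun b => u (x - b)) (derive1 u (x - a) * - 1).
  exact: (is_derive1_comp (duD _) dshift).
have dinv : is_derive a 1 (fun b : R => b^-1) (- a ^- 2 *: 1).
  exact: is_deriveV.
have dchord : is_derive a 1 (chord_slope u x)
    ((u x - u (x - a)) * (- a ^- 2) + a^-1 * derive1 u (x - a)).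
  rewrite /chord_slope; apply: is_derive_eq.
  rewrite /GRing.scale/=; ring.
have dcompo := is_derive1_comp (is_derive1_atan (chord_slope u x a)) dchord.
apply: is_derive_eq dcompo _.
rewrite /chord_slope; field.
by rewrite a0 andbT gt_eqF// ltr_wpDl ?sqr_ge0// exprn_even_gt0.
Qed.

(** * Comparison of two principal values *)

Lemma chord_slope_cvg0 (R : realType) (u : R -> R) (x : R) :
  derivable u x 1 -> chord_slope u x a @[a --> 0^'] --> derive1 u x.
Proof.
move=> du; have : h^-1 *: ((u \o shift x) h%:A - u x) @[h --> 0^'] --> 'D_1 u x.
  exact: du.
rewrite derive1E => /cvgrPdist_lt du0; apply/cvgrPdist_lt => e e0.
have /nbhs_ballP[d /= d0 Hd] := du0 e e0.
apply/nbhs_ballP; exists d => //= a; rewrite /ball/= sub0r normrN => ad a0.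
have := Hd (- a); rewrite /ball/= sub0r !normrN => /(_ ad).
rewrite oppr_eq0 => /(_ a0).
have -> // : (- a)^-1 *: (u ((- a)%:A + x) - u x) = chord_slope u x a.
rewrite /chord_slope /GRing.scale/= mulr1 [- a + x]addrC invrN mulNr.
by rewrite -mulrN opprB mulrC.
Qed.

Lemma chord_slope_cvgy (R : realType) (u : R -> R) (x : R) :
  u y @[y --> -oo] --> 0 -> chord_slope u x a @[a --> +oo] --> 0.
Proof.
move=> u0; rewrite /chord_slope -[X in _ --> X](mulr0 (u x - 0)).
apply: cvgM; last by apply/gtr0_cvgV0 => //; exact: nbhs_pinfty_gt.
apply: cvgB; first exact: cvg_cst.
apply: cvg_comp u0; apply/cvgrNyPlt => M.
near=> a; rewrite ltrBlDr -ltrBlDl; near: a; apply: nbhs_pinfty_gt; exact: num_real.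
Unshelve. all: by end_near. Qed.

Lemma chord_slope_cvgNy (R : realType) (u : R -> R) (x : R) :
  u y @[y --> +oo] --> 0 -> chord_slope u x (- a) @[a --> +oo] --> 0.
Proof.
move=> u0; rewrite /chord_slope -[X in _ --> X](mulr0 (u x - 0)).
apply: cvgM; last first.
  rewrite -oppr0; under eq_fun do rewrite invrN.
  by apply: cvgN; apply/gtr0_cvgV0 => //; exact: nbhs_pinfty_gt.
apply: cvgB; first exact: cvg_cst.
apply: cvg_comp u0; apply/cvgryPgt => M.
near=> a; rewrite opprK -ltrBlDl; near: a; apply: nbhs_pinfty_gt; exact: num_real.
Unshelve. all: by end_near. Qed.

(** The difference of the two integrands is at most the derivative of
    [H a = atan (chord_slope v x a) - atan (chord_slope u x a) + k * atan a]
    on both half-lines.  The chord slopes have the same limits for [u] and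
    [v] at [0] and at infinity, so that the first two terms contribute nothing in the
    limit, whereas [k * atan] contributes at most [k * pi]. *)
Lemma pv_difference_le (R : realType) (u v : R -> R) (x k lu lv : R) :
  0 <= k ->
  (forall y, derivable u y 1) -> (forall y, derivable v y 1) ->
  continuous (derive1 u) -> continuous (derive1 v) ->
  derive1 u x = derive1 v x ->
  u y @[y --> +oo] --> 0 -> u y @[y --> -oo] --> 0 ->
  v y @[y --> +oo] --> 0 -> v y @[y --> -oo] --> 0 ->
  let A (w : R -> R) (a : R) := a * (derive1 w x - derive1 w (x - a)) /
                 ((w x - w (x - a)) ^+ 2 + a ^+ 2) in
  let B (w : R -> R) (a : R) := (a * derive1 w x - (w x - w (x - a))) /
                 ((w x - w (x - a)) ^+ 2 + a ^+ 2) in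
  is_pv (A u) lu -> is_pv (A v) lv ->
  (forall a, a != 0 -> B u a - B v a <= k * (1 + a ^+ 2)^-1) ->
  lu - lv <= k * pi.
Proof.
move=> k0 du dv cu cv uvx uy uNy vy vNy A B [iu plu] [iv plv] Bk.
pose C (w : R -> R) (a : R) := (a * derive1 w (x - a) - (w x - w (x - a))) /
                 ((w x - w (x - a)) ^+ 2 + a ^+ 2).
have ABC w a : A w a = B w a - C w a.
  by rewrite /A /B /C -mulrBl; congr (_ / _); ring.
pose H a := atan (chord_slope v x a) - atan (chord_slope u x a) + k * atan a.
(* [C] is the derivative of the arctangent of the chord slope, [h] that of [H] *)
pose h a := C v a - C u a + k * (1 + a ^+ 2)^-1.
have dH (a : R) : a != 0 -> is_derive a 1 H (h a).
  move=> a0; have dCu := is_derive_atan_chord _ _ x _ du a0.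
  have dCv := is_derive_atan_chord _ _ x _ dv a0.
  rewrite -/(C u a) -/(C v a) in dCu dCv.
  have dk : is_derive a 1 (k \*: (@atan R : R -> R)) (k *: (1 + a ^+ 2)^-1).
    exact: is_deriveZ.
  exact: (is_deriveD (is_deriveB dCv dCu) dk).
have cC (w : R -> R) (a : R) : (forall y, derivable w y 1) -> continuous (derive1 w) ->
    a != 0 -> {for a, continuous (C w)}.
  move=> dw cw a0; rewrite /C.
  have cshift : {for a, continuous (fun b : R => x - b)}.
    by apply: continuousB => //; exact: cst_continuous.
  have cws : {for a, continuous (fun b => w x - w (x - b))}.
    apply: continuousB; first exact: cst_continuous.
    apply: continuous_comp => //.
    exact/differentiable_continuous/derivable1_diffP.
  apply: continuousM.
    apply: continuousB => //; apply: continuousM => //.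
    by apply: continuous_comp => //; exact: cw.
  apply: continuousV.
    by rewrite gt_eqF// ltr_wpDl ?sqr_ge0// exprn_even_gt0.
  by apply: continuousD; apply: continuousM.
have ch (a : R) : a != 0 -> {for a, continuous h}.
  move=> a0; apply: continuousD.
    by apply: continuousB; exact: cC.
  apply: continuousM; first exact: cst_continuous.
  apply: continuousV; first by rewrite gt_eqF// ltr_pwDl// sqr_ge0.
  by apply: continuousD; [exact: cst_continuous|apply: continuousM].
have Ah (a : R) : a != 0 -> A u a - A v a <= h a.
  by move=> /Bk; rewrite !ABC /h; lra.
pose ann (e r : R) := [set a : R | e < `|a| < r].
have Ile e r : 0 < e -> e < r ->
    \int[@lebesgue_measure R]_(a in ann e r) A u a -
    \int[@lebesgue_measure R]_(a in ann e r) A v a <=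
    H r - H e + (H (- e) - H (- r)).
  move=> e0 er.
  have annE : ann e r = `]e, r[%classic `|` `](- r), (- e)[%classic.
    rewrite /ann; apply/seteqP; split => a /=; rewrite !in_itv/= ltr_normr ltr_norml.
      by move=> /andP[/orP[]? /andP[? ?]]; [left|right]; apply/andP; split; lra.
    by move=> [] /andP[? ?]; apply/and3P; split; lra.
  have mann : measurable (ann e r : set (measurableTypeR R)).
    by rewrite annE; exact: measurableU.
  have iAB := integrableB mann (iu e r e0) (iv e r e0).
  rewrite -RintegralB//; [|exact: iu|exact: iv].
  rewrite annE in iAB *.
  have disj : [disjoint `]e, r[%classic & `](- r), (- e)[%classic].
    apply/disj_setPS => a [] /=; rewrite !in_itv/= => /andP[? ?] /andP[? ?]; lra.
  rewrite Rintegral_setU//.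
  have iI (I : set (measurableTypeR R)) : measurable I ->
      I `<=` `]e, r[%classic `|` `](- r), (- e)[%classic ->
      lebesgue_measure.-integrable I (EFin \o (fun a => A u a - A v a)).
    by move=> mI sI; apply: (integrableS _ mI sI iAB); exact: measurableU.
  have ne0 (a : R) : e <= a <= r \/ - r <= a <= - e -> a != 0.
    by case=> /andP[? ?]; [rewrite gt_eqF|rewrite lt_eqF]; lra.
  have ne0' (a : R) : e < a < r \/ - r < a < - e -> a != 0.
    by move=> H'; apply: ne0; case: H' => /andP[/ltW -> /ltW ->]; [left|right].
  apply: lerD; apply: (@integral_le_primitive _ _ H h); first [lra|idtac].
  - by apply: iI => // a ?; left.
  - by move=> a ?; apply/dH/ne0; left.
  - by move=> a ?; apply/ch/ne0; left.
  - by move=> a ?; apply/Ah/ne0'; left.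
  - by apply: iI => // a ?; right.
  - by move=> a ?; apply/dH/ne0; right.
  - by move=> a ?; apply/ch/ne0; right.
  - by move=> a ?; apply/Ah/ne0'; right.
have cA (q : R -> R) l (F : set_system R) : Filter F ->
    q a @[a --> F] --> l -> atan (q a) @[a --> F] --> atan l.
  move=> FF; apply: continuous_cvg; exact: continuous_atan.
pose G a := atan (chord_slope v x a) - atan (chord_slope u x a).
have oppr_right : - e @[e --> (0 : R)^'+] --> (0 : R)^'.
  move=> P /nbhs_ballP[d /= d0 Hd]; apply/nbhs_ballP; exists d => //= e.
  rewrite /ball/= sub0r normrN => ed e0; apply: Hd.
    by rewrite /ball/= sub0r opprK.
  by rewrite oppr_eq0 gt_eqF.
have cu0 := chord_slope_cvg0 _ _ _ (du x).
have cv0 := chord_slope_cvg0 _ _ _ (dv x).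
have Gr0 : G e @[e --> 0^'+] --> 0.
  rewrite -[X in _ --> X](subrr (atan (derive1 u x))) {1}uvx.
  apply: cvgB; apply: cA; exact: cvg_dnbhs_at_right.
have Gl0 : G (- e) @[e --> 0^'+] --> 0.
  rewrite -[X in _ --> X](subrr (atan (derive1 u x))) {1}uvx.
  apply: cvgB; apply: cA.
    exact: (cvg_comp (@GRing.opp R) (chord_slope v x) oppr_right cv0).
  exact: (cvg_comp (@GRing.opp R) (chord_slope u x) oppr_right cu0).
have Gy : G r @[r --> +oo] --> 0.
  rewrite -(subrr (@atan R 0)).
  by apply: cvgB; apply: cA; exact: chord_slope_cvgy.
have GNy : G (- r) @[r --> +oo] --> 0.
  rewrite -(subrr (@atan R 0)).
  by apply: cvgB; apply: cA; exact: chord_slope_cvgNy.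
have Gall : G p.2 - G p.1 + (G (- p.1) - G (- p.2)) + k * pi
    @[p --> filter_prod (0 : R)^'+ (pinfty_nbhs R)] --> k * pi.
  rewrite -[X in _ --> X]add0r -[X in _ --> X + _]addr0 -{2 3}(subrr 0).
  apply: cvgD; last exact: cvg_cst.
  apply: cvgD; apply: cvgB.
  - exact: cvg_comp (@cvg_snd _ _ _ _ _) Gy.
  - exact: cvg_comp (@cvg_fst _ _ _ _ _) Gr0.
  - exact: cvg_comp (@cvg_fst _ _ _ _ _) Gl0.
  - exact: cvg_comp (@cvg_snd _ _ _ _ _) GNy.
apply: (ler_cvg_to (cvgB plu plv) Gall).
exists ([set e | 0 < e < 1], [set r | 1 < r]) => /=.
  split; last by apply: nbhs_pinfty_gt; exact: num_real.
  near=> e; apply/andP; split; near: e; [exact: nbhs_right_gt|exact: nbhs_right_lt].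
move=> [e r] /= [/andP[e0 e1] r1].
have er : e < r by lra.
apply: le_trans (Ile e r e0 er) _.
have := atan_ltpi2 r; have := atan_gtNpi2 (- r).
have := le_atan (_ : - e <= e) => /(_ ltac:(lra)).
rewrite /H -/(G r) -/(G e) -/(G (- e)) -/(G (- r)) => h1 h2 h3.
suff : k * (atan r - atan e + (atan (- e) - atan (- r))) <= k * pi by lra.
by rewrite ler_wpM2l//; lra.
Unshelve. all: by end_near. Qed.

(** * Maximum principle *)

Lemma derive1_eq_at_max (R : realType) (u v : R -> R) (x : R) :
  (forall y, derivable u y 1) -> (forall y, derivable v y 1) ->
  (forall y, u y - v y <= u x - v x) -> derive1 u x = derive1 v x.
Proof.
move=> du dv uvx; apply/eqP; rewrite -subr_eq0 !derive1E; apply/eqP.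
have xx : x - 1 <= x + 1 by lra.
have duv y : derivable (u - v) y 1 by apply: derivableB.
have [|y _|dmax] := @derive1_at_max R (u - v) (x - 1) (x + 1) x xx (fun y _ => duv y).
- by rewrite in_itv/=; lra.
- exact: uvx.
by rewrite -deriveB//; exact: derive_val.
Qed.

Lemma attains_max_norm (R : realType) (h : R -> R) :
  continuous h -> h y @[y --> +oo] --> 0 -> h y @[y --> -oo] --> 0 ->
  exists x, forall y, `|h y| <= `|h x|.
Proof.
move=> ch hy hNy; have [h0|] := pselect (forall y, h y = 0).
  by exists 0 => y; rewrite !h0.
move=> /existsNP[x0 /eqP hx0].
have e0 : 0 < `|h x0| by rewrite normr_gt0.
have [A [_ HA]] : \forall y \near +oo, `|h y| < `|h x0|.
  by move/cvgrPdist_lt : hy => /(_ _ e0); apply: filterS => y; rewrite sub0r normrN.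
have [B [_ HB]] : \forall y \near -oo, `|h y| < `|h x0|.
  by move/cvgrPdist_lt : hNy => /(_ _ e0); apply: filterS => y; rewrite sub0r normrN.
(* outside [[- X, X]] the values are below the one at [x0], which lies inside *)
pose X := `|A| + `|B| + `|x0|.
have X0 : - X <= X by have := normr_ge0 A; have := normr_ge0 B; have := normr_ge0 x0; rewrite /X; lra.
have cnh : {within `[- X, X], continuous (fun y => `|h y|)}.
  apply: continuous_subspaceT => y.
  by apply: continuous_comp; [exact: ch|exact: norm_continuous].
have [x _ Hx] := EVT_max X0 cnh.
have x0X : x0 \in `[- X, X].
  rewrite in_itv/= -ler_norml /X; have := normr_ge0 A; have := normr_ge0 B; lra.
exists x => y; have [yX|] := boolP (y \in `[- X, X]); first exact: Hx.
rewrite in_itv/= negb_and -!ltNge => /orP[yX|Xy].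
- apply/ltW/(lt_le_trans _ (Hx _ x0X))/HB; apply: lt_le_trans yX _.
  have := ler_norm (- B); rewrite normrN /X.
  by have := normr_ge0 A; have := normr_ge0 x0; lra.
- apply/ltW/(lt_le_trans _ (Hx _ x0X))/HA; apply: le_lt_trans Xy.
  have := ler_norm A; rewrite /X.
  by have := normr_ge0 B; have := normr_ge0 x0; lra.
Qed.

(** The two consequences of the modulus of continuity used below: slopes have
    bounded oscillation on the whole line, and small oscillation on short
    intervals, both uniformly in time. *)
Lemma slope_modulus_uniform (R : realType) (T : R) (f : R -> R -> R) :
  slope_modulus T f ->
  (exists2 M : R, 0 <= M & forall t x y, t \in `[0, T] ->
     `|dx f y t - dx f x t| <= M) /\
  (forall e : R, 0 < e -> exists2 d : R, 0 < d & forall t x y, t \in `[0, T] ->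
     `|y - x| <= d -> `|dx f y t - dx f x t| <= e).
Proof.
move=> [rho [crho mrho [M HM] rho0 Hrho]].
have Hd t x y : t \in `[0, T] -> `|dx f y t - dx f x t| <= rho `|y - x|.
  by move=> tT; have := Hrho y (y - x) t tT; rewrite /delta subKr.
split.
  exists M; first by have /andP[] := HM 0 (lexx _); apply: le_trans.
  move=> t x y tT; apply: le_trans (Hd _ _ _ tT) _.
  by have /andP[] := HM _ (normr_ge0 (y - x)).
move=> e e0.
move: crho => /(continuous_within_itvcyP _ _)[_]; rewrite rho0.
move=> /cvgr_le/(_ _ e0)/nbhs_ballP[d /= d0 Hrhod].
exists (d / 2); first by rewrite divr_gt0.
move=> t x y tT yxd; apply: le_trans (Hd _ _ _ tT) _.
apply: (@le_trans _ _ (rho (d / 2))).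
  by apply: mrho => //; rewrite in_itv/= andbT//; lra.
by apply: Hrhod; rewrite ?divr_gt0//= /ball/= sub0r normrN gtr0_norm; lra.
Qed.

(** If [exp (- (K + 1) s) k s] is maximal on [[0, t]] at [t], the backward
    difference quotients of [k] at [t] are at least about [(K + 1) k t], which a
    derivative at most [K k t] does not allow.  The quantitative version compares
    slope [K + 1/2] with [exp y >= 1 + y] over a short step [d]. *)
Lemma slower_than_exponential (R : realType) (T t K D : R) (k : R -> R) :
  0 < t -> t <= T -> 0 <= K ->
  (k s - k t) / (s - t) @[s --> within `[0, T] t^'] --> D ->
  0 < k t -> D <= K * k t ->
  (forall s, 0 <= s <= t ->
     expR (- (K + 1) * s) * k s <= expR (- (K + 1) * t) * k t) -> False.
Proof.
move=> t0 tT K0 kD kt0 DK kexp.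
have DK' : D < (K + 2^-1) * k t by rewrite mulrDl (le_lt_trans DK)// ltrDl mulr_gt0.
have [e e0 He] := local_increment _ _ _ _ _ _ kD DK'.
pose c := K + 1.
have c1 : 1 <= c by rewrite /c; lra.
(* [d < 1 / (2 c^2)] makes the second-order term of the expansion below
   smaller than the gap between [K + 1/2] and [K + 1] *)
have [d [d0 de dt_ dc]] : exists d : R, [/\ 0 < d, d < e, d <= t & d * (c * c) < 2^-1].
  exists (Num.min (e / 2) (Num.min t ((4 * (c * c))^-1))); split.
  - by rewrite !lt_min; apply/and3P; split; rewrite ?divr_gt0 ?invr_gt0//; nra.
  - by rewrite gt_min; apply/orP; left; lra.
  - by rewrite !ge_min lexx orbT.
  - have cc : 0 < c * c by nra.
    rewrite -ltr_pdivlMr// !gt_min; apply/orP; right; apply/orP; right.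
    by rewrite invfM ltr_pM2r ?invr_gt0//; lra.
have := He (t - d) t; rewrite subKr subrr e0 lexx tT => H.
have {}H : k t - k (t - d) <= (K + 2^-1) * k t * d.
  by apply: H => //; lra.
have := kexp (t - d); have -> : 0 <= t - d <= t by lra.
move=> /(_ isT); rewrite mulrBr expRD -mulrA ler_pM2l ?expR_gt0// mulNr opprK.
move=> Hexp; have E1 : 1 + c * d <= expR (c * d) by exact: expR_ge1Dx.
have kd0 : 0 <= k (t - d).
  have : (K + 2^-1) * k t * d <= k t.
    have : (K + 2^-1) * d <= 1 by rewrite /c in dc; nra.
    nra.
  lra.
have : (1 + c * d) * k (t - d) <= k t.
  by apply: le_trans Hexp; rewrite ler_wpM2r.
move=> H1; rewrite (_ : K + 2^-1 = c - 2^-1) in H; last by rewrite /c; lra.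
have : (1 + c * d) * (1 - (c - 2^-1) * d) <= 1.
  rewrite -(ler_pM2r kt0) mul1r; apply: le_trans H1; rewrite -mulrA ler_wpM2l//.
    by nra.
  by lra.
nra.
Qed.

Lemma space_slice_continuous (R : realType) (T : R) (f : R -> R -> R) t :
  (forall x t, t \in `[0, T] -> derivable (f^~ t) x 1) -> t \in `[0, T] ->
  continuous (f^~ t).
Proof.
move=> df tT x; apply: differentiable_continuous.
exact/derivable1_diffP/df.
Qed.

Lemma dx_continuous (R : realType) (T : R) (f : R -> R -> R) t :
  slope_modulus T f -> t \in `[0, T] -> continuous ((dx f)^~ t).
Proof.
move=> /slope_modulus_uniform[_ Hf] tT x; apply/cvgrPdist_le => e e0.
have [d d0 Hd] := Hf e e0; apply/nbhs_ballP; exists d => //= y xy.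
by rewrite distrC Hd// distrC ltW.
Qed.

(** At a nonnegative maximum of [`|f - g|] the slopes agree, so that the
    kernel estimate and the comparison of principal values apply, with constants
    that depend only on the moduli of the slopes. *)
Lemma muskat_difference_at_max (R : realType) (T : R) (f0 g0 : R -> R)
    (f g : R -> R -> R) :
  muskat_class T f0 f -> muskat_class T g0 g ->
  exists2 K : R, 0 <= K & forall t x, t \in `[0, T] ->
    (forall y, `|f y t - g y t| <= f x t - g x t) ->
    dt T f x t - dt T g x t <= K * (f x t - g x t).
Proof.
move=> [[df _ pf _] _ vf _ sf] [[dg _ pg _] _ vg _ sg].
have [[M1 M10 HM1] Hr1] := slope_modulus_uniform _ _ _ sf.
have [[M2 M20 HM2] Hr2] := slope_modulus_uniform _ _ _ sg.
have [r1 r10 {}Hr1] := Hr1 1 ltr01; have [r2 r20 {}Hr2] := Hr2 1 ltr01.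
pose M := M1 + M2; pose r := Num.min r1 r2.
have r0 : 0 < r by rewrite lt_min r10.
pose k := 2 * M ^+ 2 * ((1 + r ^+ 2) / r ^+ 2).
have k0 : 0 <= k.
  by rewrite !mulr_ge0 ?sqr_ge0// ?invr_ge0 ?addr_ge0 ?sqr_ge0.
exists (k * pi); first by rewrite mulr_ge0// pi_ge0.
move=> t x tT xmax; set m := f x t - g x t.
have m0 : 0 <= m by apply: le_trans (xmax x).
have eqx : derive1 (f^~ t) x = derive1 (g^~ t) x.
  apply: derive1_eq_at_max => [y|y|y]; [exact: df|exact: dg|].
  exact: le_trans (ler_norm _) (xmax y).
have [fy fNy] := vf t tT; have [gy gNy] := vg t tT.
rewrite mulrAC; apply: (@pv_difference_le R (f^~ t) (g^~ t) x (k * m)) => //.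
- by rewrite mulr_ge0.
- by move=> y; exact: df.
- by move=> y; exact: dg.
- exact: dx_continuous sf tT.
- exact: dx_continuous sg tT.
- exact: pf.
- exact: pg.
move=> a a0; rewrite -eqx.
have -> : k * m = 2 * m * M ^+ 2 * ((1 + r ^+ 2) / r ^+ 2) by rewrite /k; ring.
have chordf c : (forall y, `|y - x| <= `|a| -> `|dx f y t - dx f x t| <= c) ->
    `|(f x t - f (x - a) t) / a - derive1 (f^~ t) x| <= c.
  by apply: chord_slope_dist => // y; exact: df.
have chordg c : (forall y, `|y - x| <= `|a| -> `|dx g y t - dx g x t| <= c) ->
    `|(g x t - g (x - a) t) / a - derive1 (f^~ t) x| <= c.
  by rewrite eqx; apply: chord_slope_dist => // y; exact: dg.
apply: chord_kernel_difference_le => //.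
- by rewrite addr_ge0.
- have := xmax (x - a); rewrite ler_norml => /andP[h1 h2].
  by apply/andP; split; rewrite /m in h1 h2 *; lra.
- apply: chordf => y _; apply: le_trans (HM1 _ _ _ tT) _; rewrite /M; lra.
- apply: chordg => y _; apply: le_trans (HM2 _ _ _ tT) _; rewrite /M; lra.
- rewrite le_min => /andP[ar1 ar2]; split.
  + by apply: chordf => y ya; apply: Hr1 => //; exact: le_trans ar1.
  + by apply: chordg => y ya; apply: Hr2 => //; exact: le_trans ar2.
Qed.

Theorem theorem1p4 (R : realType) (T : R) (f0 : R -> R) (f : R -> R -> R) :
  0 < T ->
  f0 \in Lfun (@lebesgue_measure R) +oo%E ->
  muskat_class T f0 f ->
  forall g : R -> R -> R, muskat_class T f0 g ->
  forall x t : R, t \in `[0, T] -> g x t = f x t.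
Proof.
move=> T0 _ Hf g Hg.
(* both orders are needed: the sign of [f - g] where its absolute value is
   largest is not known *)
have [K1 K10 HK1] := muskat_difference_at_max _ _ _ _ _ _ Hf Hg.
have [K2 K20 HK2] := muskat_difference_at_max _ _ _ _ _ _ Hg Hf.
case: Hf => [[df ft _ fi] _ vf bf _]; case: Hg => [[dg gt _ gi] _ vg bg _].
have [L1 L10 HL1] := time_lipschitz _ _ _ df bf.
have [L2 L20 HL2] := time_lipschitz _ _ _ dg bg.
pose h t x := f x t - g x t.
have hmax t : exists x, t \in `[0, T] -> forall y, `|h t y| <= `|h t x|.
  have [tT|] := boolP (t \in `[0, T]); last by exists 0.
  have [fy fNy] := vf t tT; have [gy gNy] := vg t tT.
  have [|||x Hx] := @attains_max_norm R (h t); last by exists x.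
  - move=> y; apply: cvgB; [exact: space_slice_continuous df tT y|].
    exact: space_slice_continuous dg tT y.
  - by rewrite -[X in _ --> X](subrr 0); exact: cvgB.
  - by rewrite -[X in _ --> X](subrr 0); exact: cvgB.
have [X HX] := choice hmax.
pose m t := `|h t (X t)|; pose w t := expR (- (K1 + K2 + 1) * t) * m t.
(* [m] inherits the Lipschitz constant: test the maximality at time [s] with
   the maximum point of time [t] *)
have mL s t : s \in `[0, T] -> t \in `[0, T] -> m t - m s <= (L1 + L2) * `|t - s|.
  move=> sT tT; have := HX s sT (X t); rewrite -/(m s) => hs.
  have := HL1 (X t) s t sT tT; have := HL2 (X t) s t sT tT.
  have -> : m t = `|h s (X t) + ((f (X t) t - f (X t) s) - (g (X t) t - g (X t) s))|.
    by rewrite /m /h; congr `|_|; ring.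
  have := ler_normD (h s (X t)) ((f (X t) t - f (X t) s) - (g (X t) t - g (X t) s)).
  have := ler_normB (f (X t) t - f (X t) s) (g (X t) t - g (X t) s).
  lra.
have cm : {within `[0, T], continuous m}.
  apply/subspace_continuousP => t tT; apply/cvgrPdist_lt => e e0.
  have L0 : 0 < L1 + L2 + 1 by lra.
  have d0 : 0 < e / (L1 + L2 + 1) by rewrite divr_gt0.
  apply/nbhs_ballP; exists (e / (L1 + L2 + 1)) => //= s ts sT.
  have {}ts : `|t - s| * (L1 + L2 + 1) < e by rewrite -ltr_pdivlMr.
  have ts0 := normr_ge0 (t - s).
  have := mL s t sT tT; have := mL t s tT sT; rewrite [`|s - t|]distrC => h1 h2.
  by rewrite /from_subspace ltr_norml; apply/andP; split; lra.
have cw : {within `[0, T], continuous w}.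
  have cexp : {within `[0, T], continuous (fun t => expR (- (K1 + K2 + 1) * t))}.
    apply: continuous_subspaceT => t; apply: continuous_comp.
      by apply: continuousM => //; exact: cst_continuous.
    exact: continuous_expR.
  by move=> t; exact: (continuousM (cexp t) (cm t)).
have [tm tmT wmax] := EVT_max (ltW T0) cw.
suff wtm0 : w tm <= 0.
  move=> x t tT; have : m t <= 0.
    by rewrite -(ler_pM2l (expR_gt0 (- (K1 + K2 + 1) * t))) mulr0 (le_trans (wmax t tT)).
  move=> mt0; have := le_trans (HX t tT x) mt0.
  by rewrite normr_le0 subr_eq0 => /eqP ->.
rewrite leNgt; apply/negP => wtm.
have mtm : 0 < m tm.
  by move: wtm; rewrite /w pmulr_rgt0// expR_gt0.
(* the data agree at time [0] *)
have tm0 : 0 < tm.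
  move: (tmT); rewrite in_itv/= => /andP[tm0 _].
  rewrite lt_neqAle tm0 andbT; apply/eqP => tmE.
  by move: mtm; rewrite -tmE /m /h fi gi subrr normr0 ltxx.
have tmT' : tm <= T by move: tmT; rewrite in_itv/= => /andP[].
have key (k : R -> R) (D : R) :
   (k s - k tm) / (s - tm) @[s --> within `[0, T] tm^'] --> D ->
   (forall s, s \in `[0, T] -> k s <= m s) -> k tm = m tm ->
   D <= (K1 + K2) * k tm -> False.
  move=> kD km ktm DK; apply: (slower_than_exponential _ _ _ _ _ _ tm0 tmT' _ kD _ DK).
  - by rewrite addr_ge0.
  - by rewrite ktm.
  - move=> s /andP[s0 stm]; have sT : s \in `[0, T] by rewrite in_itv/= s0 (le_trans stm).
    by rewrite ktm; apply: le_trans (wmax s sT); rewrite ler_pM2l ?expR_gt0// km.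
have [hpos|hneg] := leP 0 (h tm (X tm)).
- apply: (key (fun s => h s (X tm)) (dt T f (X tm) tm - dt T g (X tm) tm)).
  + apply: cvg_trans (cvgB (ft (X tm) tm tmT) (gt (X tm) tm tmT)).
    apply: near_eq_cvg; apply: nearW => s /=.
    transitivity ((f (X tm) s - f (X tm) tm) / (s - tm) -
      (g (X tm) s - g (X tm) tm) / (s - tm)) => //.
    by rewrite -mulrBl /h; congr (_ / _); ring.
  + by move=> s sT; apply: le_trans (ler_norm _) (HX s sT _).
  + by rewrite /m ger0_norm.
  + have := HK1 tm (X tm) tmT; rewrite -/(h tm (X tm)) => HK.
    apply: le_trans (HK _) _; last by rewrite ler_wpM2r// lerDl.
    by move=> y; have := HX tm tmT y; rewrite [leRHS]ger0_norm.
- apply: (key (fun s => - h s (X tm)) (dt T g (X tm) tm - dt T f (X tm) tm)).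
  + apply: cvg_trans (cvgB (gt (X tm) tm tmT) (ft (X tm) tm tmT)).
    apply: near_eq_cvg; apply: nearW => s /=.
    transitivity ((g (X tm) s - g (X tm) tm) / (s - tm) -
      (f (X tm) s - f (X tm) tm) / (s - tm)) => //.
    by rewrite -mulrBl /h; congr (_ / _); ring.
  + move=> s sT; apply: le_trans (HX s sT (X tm)).
    by rewrite -normrN ler_norm.
  + by rewrite /m ltr0_norm.
  + have := HK2 tm (X tm) tmT; rewrite -[g _ _ - f _ _]opprB -/(h tm (X tm)) => HK.
    apply: le_trans (HK _) _; last by rewrite ler_wpM2r ?lerDr// oppr_ge0 ltW.
    by move=> y; have := HX tm tmT y; rewrite [leRHS]ltr0_norm// distrC.
Qed.
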